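(* Any history-based swap dynamic with minimal coverage is manipulable.
   Context: Housing market: an instance is $I=\langle \mathcal{N},\mathcal{R},L,\pi^0\rangle$ with $\mathcal{N}$ a set of $n$ agents, $\mathcal{R}$ a set of $n$ resources, $L$ a profile of strict linear orders $\succ_i$ over $\mathcal{R}$, one for each agent $a_i$, and $\pi^0$ an initial allocation; an allocation $\pi$ is a bijective assignment of one resource $\pi_{a_i}$ to each agent $a_i$. Standing assumption: instances are single-peaked, i.e. there is a linear order $\lhd$ over $\mathcal{R}$ such that for every agent $a_i$ with top resource $t_i$ and all resources $r,r'$, if $r'\lhd r\lhd t_i$ or $t_i\lhd r\lhd r'$ then $r\succ_i r'$. A swap-deal $\langle a_x,a_y\rangle$ between two distinct agents exchanges their current resources; it is improving for an agent if she strictly prefers the resource she would receive to the one she holds, and improving if it is so for both agents. History-based swap dynamic: a history $h$ is a finite sequence of proposed swap-deals, each with its status (successful or not). A history-based selection heuristic $\sigma$ is a function which, for every finite set of agents $\mathcal{N}$ and every history $h$ over $\mathcal{N}$, returns a swap-deal $\sigma(\mathcal{N},h)$ between two agents of $\mathcal{N}$. The associated swap dynamic starts on $I$ from $\pi^0$ and the empty history; at each round the deal $\sigma(\mathcal{N},h)$ is proposed; if both agents accept, it is implemented (the deal is successful), otherwise the allocation is unchanged; the deal with its status is appended to $h$. The process stops when, for every pair of agents $a_x,a_y$, the deal $\langle a_x,a_y\rangle$ has been unsuccessfully proposed at some round after which no successful deal involved $a_x$ or $a_y$. The outcome is the final allocation (if the process never stops, the allocation which is constant from some round on). A truthful agent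 accepts a proposed deal if and only if it is improving for her. The execution on $I$ is the one in which all agents are truthful. Minimal coverage: $\sigma$ has minimal coverage if in the execution on every instance, for every pair of distinct agents $a_x,a_y$ there is at least one round at which the swap-deal $\langle a_x,a_y\rangle$ is proposed. A swap dynamic is strategy-proof if, for every instance, at no point during the procedure can an agent be better off by accepting a deal that is not improving for her or by refusing one that is; otherwise it is manipulable. That is, it is manipulable if there are an instance, an agent $a_i$ and a round of the procedure such that, if $a_i$ deviates from the truthful answer at this round (all other agents being truthful throughout, and $a_i$ being truthful at the other rounds), she holds in the outcome a resource she strictly prefers (according to $\succ_i$) to the resource she would hold in the outcome of the truthful execution. *)

(* Defs.v *)
From mathcomp Require Import all_boot.

Set Implicit Arguments.
Unset Strict Implicit.
Unset Printing Implicit Defensive.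

Definition strict_linear_order (T : eqType) (lt : rel T) : Prop :=
  [/\ irreflexive lt, transitive lt & forall x y, x != y -> lt x y || lt y x].

Definition is_top (R : eqType) (pref : rel R) (t : R) : Prop :=
  forall r, r != t -> pref t r.

(* [pref i r r'] means that agent [i] strictly prefers [r] to [r']. *)
Definition single_peaked (N R : finType) (pref : N -> rel R) : Prop :=
  exists2 axis : rel R, strict_linear_order axis &
    forall i t r r', is_top (pref i) t ->
      (axis r' r && axis r t) || (axis t r && axis r r') -> pref i r r'.

Record instance (N : finType) := Instance {
  resource : finType;
  pref : N -> rel resource;
  initial : {ffun N -> resource};
  card_resource : #|resource| = #|N|;
  pref_linear : forall i, strict_linear_order (pref i);
  pref_single_peaked : single_peaked pref;
  initial_bij : bijective initial }.

(* Deals are unordered: <a_x, a_y> is the two-element set {a_x, a_y}. *)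
Definition deal (N : finType) := {d : {set N} | #|d| == 2}.

Definition partner (N : finType) (d : deal N) (i : N) : N :=
  odflt i [pick j in val d | (i \in val d) && (j != i)].

(* Chronological, oldest round first; the boolean is true for success. *)
Definition history (N : finType) := seq (deal N * bool).

(* There is no deal between two distinct agents unless #|N| >= 2; without this
   guard the type would be empty. *)
Definition selection_heuristic :=
  forall N : finType, 1 < #|N| -> history N -> deal N.

Definition stopped (N : finType) (h : history N) : bool :=
  [forall d : deal N, [exists k : 'I_(size h),
    (tnth (in_tuple h) k == (d, false)) &&
    all (fun e : deal N * bool => e.2 ==> [disjoint val e.1 & val d])
        (drop k.+1 h)]].

Section Execution.
Variables (N : finType) (I : instance N) (select : history N -> deal N).

Definition allocation := {ffun N -> resource I}.

Definition improving (p : allocation) (d : deal N) (i : N) : bool :=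
  pref i (p (partner d i)) (p i).

Definition swap (p : allocation) (d : deal N) : allocation :=
  [ffun i => p (partner d i)].

(* [lies t i]: at round [t], agent [i] gives the answer opposite to the
   truthful one. *)
Variable lies : nat -> N -> bool.

Definition successful (t : nat) (p : allocation) (d : deal N) : bool :=
  [forall i in val d, improving p d i (+) lies t i].

Definition step (t : nat) (s : allocation * history N)
    : allocation * history N :=
  let: (p, h) := s in
  if stopped h then s else
  let d := select h in
  let b := successful t p d in
  (if b then swap p d else p, rcons h (d, b)).

(* The state before round [t]; it is frozen once the process has stopped. *)
Fixpoint state (t : nat) : allocation * history N :=
  if t is t'.+1 then step t' (state t') else (initial I, [::]).

Definition proposed_at (t : nat) (d : deal N) : Prop :=
  ~~ stopped (state t).2 /\ select (state t).2 = d.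

(* Since stopping freezes the state, this covers both terminating and
   non-terminating executions. *)
Definition outcome (p : allocation) : Prop :=
  exists T, forall t, T <= t -> (state t).1 = p.

End Execution.

Definition truthful (N : finType) : nat -> N -> bool := fun _ _ => false.

Definition deviation (N : finType) (a : N) (t0 : nat) : nat -> N -> bool :=
  fun t i => (t == t0) && (i == a).

Definition minimal_coverage (sigma : selection_heuristic) : Prop :=
  forall (N : finType) (N_gt1 : 1 < #|N|) (I : instance N) (d : deal N),
    exists t, proposed_at I (sigma N N_gt1) (@truthful N) t d.

Definition manipulable (sigma : selection_heuristic) : Prop :=
  exists (N : finType) (N_gt1 : 1 < #|N|) (I : instance N)
         (a : N) (t : nat) (d : deal N) (p p' : allocation I),
    [/\ proposed_at I (sigma N N_gt1) (@truthful N) t d,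
        a \in val d,
        outcome (sigma N N_gt1) (@truthful N) p,
        outcome (sigma N N_gt1) (deviation a t) p' &
        pref a (p' a) (p a)].

(* Main.v *)
Require Import Defs.
From mathcomp Require Import all_boot zify.

Set Implicit Arguments.
Unset Strict Implicit.
Unset Printing Implicit Defensive.

(** Take three agents [a], [b], [c], where [{a, b}] is the first deal proposed,
    and call each resource after its initial owner. On the axis [a, c, b], let
    [a] and [b] have the preferences [c > a > b], and [c] the preferences
    [b > c > a]. When all are truthful, only the deal [{b, c}] can succeed,
    after which [b] keeps the resource [c], so that [a] ends with her own
    resource. If instead [a] accepts the first deal, only [{a, c}] can succeed
    next, and it gives [a] her top resource. That deal is eventually proposed:
    until then the history is that of the truthful execution on a market where
    [a] and [b] have each other's resource as top and [c] her own, and minimal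
    coverage applies to that market. *)

(** * Linear orders read off lists, best resource or left end of the axis first *)

Definition ranking (T : eqType) (s : seq T) : rel T :=
  fun x y => index x s < index y s.

Lemma ranking_strict_linear (T : eqType) (s : seq T) :
  (forall x, x \in s) -> strict_linear_order (ranking s).
Proof.
move=> s_all; split=> [x|y x z|x y xy]; rewrite /ranking ?ltnn //.
  exact: ltn_trans.
by rewrite -neq_ltn; apply: contra_neq xy => /index_inj; apply.
Qed.

(** * Deals as unordered pairs of agents *)

Section Deals.
Variables (N : finType) (x y : N) (d : deal N).
Hypotheses (xy : x != y) (dE : val d = [set x; y]).

Lemma partnerl : partner d x = y.
Proof.
rewrite /partner; case: pickP => [j|/(_ y)].
  by rewrite dE !inE eqxx /= => /andP[/orP[]/eqP-> //]; rewrite eqxx.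
by rewrite dE !inE !eqxx orbT /= eq_sym xy.
Qed.

(** By the default value of [partner], an outsider to the deal is her own partner, so [swap] leaves
    her resource in place. *)
Lemma partner_out i : i \notin val d -> partner d i = i.
Proof.
by move=> id; rewrite /partner; case: pickP => // j; rewrite (negPf id) andbF.
Qed.

End Deals.

Lemma partnerr (N : finType) (x y : N) (d : deal N) :
  x != y -> val d = [set x; y] -> partner d y = x.
Proof. by rewrite eq_sym setUC; apply: partnerl. Qed.

Lemma successfulE (N : finType) (I : instance N) lies t
    (p : allocation I) (d : deal N) (x y : N) :
    x != y -> val d = [set x; y] ->
  successful lies t p d = (pref x (p y) (p x) (+) lies t x) &&
                          (pref y (p x) (p y) (+) lies t y).
Proof.
move=> xy dE; rewrite /successful /improving dE.
apply/forall_inP/andP => [ok|[okx oky] i].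
  have := ok y; have := ok x; rewrite !inE !eqxx orbT.
  by rewrite (partnerl xy dE) (partnerr xy dE) => -> // ->.
by rewrite !inE => /orP[]/eqP->; rewrite ?(partnerl xy dE) ?(partnerr xy dE).
Qed.

Section ThreeAgents.
Variables (N : finType) (a b c : N).
Hypotheses (abc : uniq [:: a; b; c]) (abcT : forall i, i \in [:: a; b; c]).

Let neqs : [/\ a != b, a != c & b != c].
Proof. by move: abc; rewrite /= !inE negb_or andbT => /andP[/andP[-> ->] ->]. Qed.

Let eqs : ((a == b = false) * (b == a = false) * (a == c = false)) *
          ((c == a = false) * (b == c = false) * (c == b = false)).
Proof.
by case: neqs => /negPf ab /negPf ac /negPf bc;
  rewrite [b == a]eq_sym [c == a]eq_sym [c == b]eq_sym.
Qed.

Definition triple (T : Type) (x y z : T) (i : N) : T :=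
  if i == a then x else if i == b then y else z.

Let tripleE T (x y z : T) : (triple x y z a = x) * (triple x y z b = y) *
                            (triple x y z c = z).
Proof. by rewrite /triple !eqxx !eqs. Qed.

Lemma deal3P (d : deal N) :
  [\/ val d = [set a; b], val d = [set a; c] | val d = [set b; c]].
Proof.
have /cards2P[x [y [xy ->]]] := valP d.
have := abcT x; have := abcT y; move: xy; rewrite !inE => + yP xP.
case/or3P: xP => /eqP->; case/or3P: yP => /eqP->; rewrite ?eqxx // => _;
  by [apply: Or31; rewrite // setUC | apply: Or32; rewrite // setUC
     | apply: Or33; rewrite // setUC].
Qed.

(** * Effect of the three possible deals on an allocation *)

Section Allocations.
Variable I : instance N.
Implicit Types (x y z : resource I) (d : deal N).

Definition alloc x y z : allocation I := [ffun i => triple x y z i].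

Lemma allocE x y z :
  (alloc x y z a = x) * (alloc x y z b = y) * (alloc x y z c = z).
Proof. by rewrite !ffunE !tripleE. Qed.

Lemma alloc_eq (p : allocation I) x y z :
  p a = x -> p b = y -> p c = z -> p = alloc x y z.
Proof.
move=> pa pb pc; apply/ffunP => i.
by have := abcT i; rewrite !inE => /or3P[]/eqP->; rewrite allocE.
Qed.

Lemma swap_ab d x y z :
  val d = [set a; b] -> swap (alloc x y z) d = alloc y x z.
Proof.
case: neqs => ab _ _ dE; apply: alloc_eq; rewrite ffunE.
- by rewrite (partnerl ab dE) allocE.
- by rewrite (partnerr ab dE) allocE.
by rewrite partner_out ?allocE // dE !inE !eqs.
Qed.

Lemma swap_ac d x y z :
  val d = [set a; c] -> swap (alloc x y z) d = alloc z y x.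
Proof.
case: neqs => _ ac _ dE; apply: alloc_eq; rewrite ffunE.
- by rewrite (partnerl ac dE) allocE.
- by rewrite partner_out ?allocE // dE !inE !eqs.
by rewrite (partnerr ac dE) allocE.
Qed.

Lemma swap_bc d x y z :
  val d = [set b; c] -> swap (alloc x y z) d = alloc x z y.
Proof.
case: neqs => _ _ bc dE; apply: alloc_eq; rewrite ffunE.
- by rewrite partner_out ?allocE // dE !inE !eqs.
- by rewrite (partnerl bc dE) allocE.
by rewrite (partnerr bc dE) allocE.
Qed.

Lemma success_ab lies t d x y z : val d = [set a; b] ->
  successful lies t (alloc x y z) d =
  (pref a y x (+) lies t a) && (pref b x y (+) lies t b).
Proof. by case: neqs => ab _ _ dE; rewrite (successfulE _ _ _ ab dE) !allocE. Qed.

Lemma success_ac lies t d x y z : val d = [set a; c] ->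
  successful lies t (alloc x y z) d =
  (pref a z x (+) lies t a) && (pref c x z (+) lies t c).
Proof. by case: neqs => _ ac _ dE; rewrite (successfulE _ _ _ ac dE) !allocE. Qed.

Lemma success_bc lies t d x y z : val d = [set b; c] ->
  successful lies t (alloc x y z) d =
  (pref b z y (+) lies t b) && (pref c y z (+) lies t c).
Proof. by case: neqs => _ _ bc dE; rewrite (successfulE _ _ _ bc dE) !allocE. Qed.

End Allocations.

(** * Single-peaked markets whose resources are the agents *)

Section Market.
Variables (orders : N -> seq N) (axis : seq N).
Hypotheses (ordersT : forall i r, r \in orders i) (axisT : forall r, r \in axis).
Hypotheses (axis3 : size axis = 3)
  (middle : forall i r, index r axis = 1 -> index r (orders i) <= 1).

(* Only the middle resource of the axis lies strictly between two others, so
   single-peakedness says that it is nobody's worst one. *)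
Lemma market_single_peaked : single_peaked (fun i => ranking (orders i)).
Proof.
exists (ranking axis); first exact: ranking_strict_linear.
move=> i t r r' top betw.
have axis_lt s : index s axis < 3 by rewrite -axis3 index_mem.
have r1 : index r axis = 1.
  by case/orP: betw (axis_lt t) (axis_lt r') => /andP[]; rewrite /ranking; lia.
have [rt r't rr'] : [/\ r != t, r' != t & r != r'].
  by split; apply: contraTneq betw => ->; rewrite /ranking; lia.
(* The top precedes both [r] and [r'], so [r] has index 1 in the preferences and [r'] at least 2. *)
have := middle i r1; have := top _ rt; have := top _ r't; rewrite /ranking.
have : index r (orders i) != index r' (orders i).
  by apply: contra_neq rr' => /index_inj; apply.
lia.
Qed.

Lemma market_bij : bijective [ffun i : N => i].
Proof. by exists id => i; rewrite ffunE. Qed.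

Definition market : instance N :=
  Instance (erefl #|N|) (fun i => ranking_strict_linear (ordersT i))
    market_single_peaked market_bij.

Lemma initial_market : initial market = alloc (I := market) a b c.
Proof. by apply: alloc_eq; rewrite ffunE. Qed.

End Market.

(** * The market to be manipulated and the market it is compared with *)

Let orders_manip := triple [:: c; a; b] [:: c; a; b] [:: b; c; a].
(** Once [a] and [b] have exchanged, all three agents hold their tops here and refuse every later
    deal. *)
Let orders_calm := triple [:: b; a; c] [:: a; b; c] [:: c; b; a].

Lemma orders_manipT i r : r \in orders_manip i.
Proof.
by have := abcT r; rewrite /orders_manip /triple; do 2?case: ifP => _;
  rewrite !inE => /or3P[]->; rewrite ?orbT.
Qed.

Lemma orders_calmT i r : r \in orders_calm i.
Proof.
by have := abcT r; rewrite /orders_calm /triple; do 2?case: ifP => _;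
  rewrite !inE => /or3P[]->; rewrite ?orbT.
Qed.

Lemma axis_manipT r : r \in [:: a; c; b].
Proof. by have := abcT r; rewrite !inE => /or3P[]->; rewrite ?orbT. Qed.

Lemma manip_middle i r : index r [:: a; c; b] = 1 -> index r (orders_manip i) <= 1.
Proof.
have := abcT r; have := abcT i; rewrite !inE.
by case/or3P=> /eqP->; case/or3P=> /eqP->; rewrite /orders_manip tripleE /= ?eqxx ?eqs.
Qed.

Lemma calm_middle i r : index r [:: a; b; c] = 1 -> index r (orders_calm i) <= 1.
Proof.
have := abcT r; have := abcT i; rewrite !inE.
by case/or3P=> /eqP->; case/or3P=> /eqP->; rewrite /orders_calm tripleE /= ?eqxx ?eqs.
Qed.

Definition manip : instance N :=
  market orders_manipT axis_manipT erefl manip_middle.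

Definition calm : instance N := market orders_calmT abcT erefl calm_middle.

Let manip_alloc x y z : allocation manip := alloc (I := manip) x y z.
Let calm_alloc x y z : allocation calm := alloc (I := calm) x y z.

Let prefE i : (@pref N manip i = ranking (orders_manip i)) *
              (@pref N calm i = ranking (orders_calm i)).
Proof. by []. Qed.

Let compute := (prefE, tripleE, eqs, eqxx).

(** * Three executions: truthful and deviating on [manip], truthful on [calm] *)

Section Runs.
Variable select : history N -> deal N.
Hypothesis select0 : val (select [::]) = [set a; b].

Lemma not_stopped_nil : ~~ stopped ([::] : history N).
(* A deal must be exhibited: were there none, the stopping condition would hold vacuously. *)
Proof. by apply/forallPn; exists (select [::]); apply/existsPn; case. Qed.

Let truth t := state manip select (@truthful N) t.
Let lie t := state manip select (deviation a 0) t.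
Let honest t := state calm select (@truthful N) t.

Let lieS t : lie t.+1 = step select (deviation a 0) t (lie t).
Proof. by []. Qed.

Let honestS t : honest t.+1 = step select (@truthful N) t (honest t).
Proof. by []. Qed.

Let lie0 : lie 0 = (manip_alloc a b c, [::]).
Proof. by congr pair; apply: initial_market. Qed.

Let honest0 : honest 0 = (calm_alloc a b c, [::]).
Proof. by congr pair; apply: initial_market. Qed.

Ltac by_deal d := let dE := fresh "dE" in
  have [dE|dE|dE] := deal3P d; rewrite ?(success_ab _ _ _ _ _ dE)
    ?(success_ac _ _ _ _ _ dE) ?(success_bc _ _ _ _ _ dE)
    /truthful /deviation !compute /orders_manip /orders_calm !compute /ranking
    /= ?compute /=.

(** Here [b] and [c] hold their tops, and every deal involves one of them. *)
Lemma truth_final t : (truth t).1 = manip_alloc a c b ->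
  (truth t.+1).1 = manip_alloc a c b.
Proof.
rewrite /truth /= /step; case: state => p h /= ->; case: ifP => //= _.
by by_deal (select h).
Qed.

(** Initially [a] refuses the resource of [b], and [c] that of [a], which leaves only the exchange
    between [b] and [c]. *)
Lemma truth_inv t :
  (truth t).1 = manip_alloc a b c \/ (truth t).1 = manip_alloc a c b.
Proof.
elim: t => [|t [IH|/truth_final]]; [by left; apply: initial_market | | by right].
move: IH; rewrite /truth /= /step; case: state => p h /= ->.
case: ifP => /= _; first by left.
by by_deal (select h); [left|left|right; apply: swap_bc].
Qed.

(** A mere proposal suffices, which is all that coverage provides: the exchange has already taken
    place or succeeds now. *)
Lemma truth_bc t d : val d = [set b; c] ->
    proposed_at manip select (@truthful N) t d ->
  (truth t.+1).1 = manip_alloc a c b.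
Proof.
move=> dE [go sel]; have [|/truth_final//] := truth_inv t.
move: go sel; rewrite /truth /= /step; case: state => p h /= /negPf-> -> ->.
rewrite (success_bc _ _ _ _ _ dE) /truthful !compute /orders_manip !compute.
by rewrite /ranking /= !compute /=; apply: swap_bc.
Qed.

(** Here [a] and [c] hold their tops, and every deal involves one of them. The time is a successor
    so that the lie at round 0 is past. *)
Lemma lie_final t : (lie t.+1).1 = manip_alloc c a b ->
  (lie t.+2).1 = manip_alloc c a b.
Proof.
rewrite [lie t.+2]lieS /step; case: (lie t.+1) => p h /= ->.
by case: ifP => //= _; by_deal (select h).
Qed.

(** A heuristic sees only deals and their statuses. Until [{a, c}] is proposed, these agree in both
    markets, so the same deals are selected. *)
Lemma lie_inv t : (lie t.+1).1 = manip_alloc c a b \/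
  [/\ (lie t.+1).1 = manip_alloc b a c, (honest t.+1).1 = calm_alloc b a c
    & (lie t.+1).2 = (honest t.+1).2].
Proof.
elim: t => [|t [/lie_final|[]]]; [right | by left | ].
  (* At round 0 the deal [{a, b}] succeeds in both markets: through the lie in [manip], truthfully
     in [calm]. *)
  rewrite lieS honestS lie0 honest0 /= (negPf not_stopped_nil).
  rewrite !(success_ab _ _ _ _ _ select0) /truthful /deviation !compute.
  rewrite /orders_manip /orders_calm !compute /ranking /= !compute /=.
  by split => //; apply: swap_ab.
rewrite [lie t.+2]lieS [honest t.+2]honestS /step.
case: (lie t.+1) => p h; case: (honest t.+1) => q h' /= -> -> <-.
case: ifP => /= _; first by right.
(* In [manip], [b] does not give the resource [a] back for her own, and [c] refuses it as her worst,
   but [{a, c}] improves both its agents. *)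
by by_deal (select h); [right|left; apply: swap_ac|right].
Qed.

(** Coverage concerns truthful executions only, hence the proposal is taken from [calm]; unless [a]
    already has her top, the common history carries it over to [manip]. *)
Lemma lie_ac t d : val d = [set a; c] ->
    proposed_at calm select (@truthful N) t d ->
  (lie t.+1).1 = manip_alloc c a b.
Proof.
move=> dE [go sel]; case: t go sel => [_ /= sel|t go sel].
  (* Round 0 is impossible, since its deal does not involve [c]. *)
  have : c \in val (select [::]) by rewrite sel dE !inE eqxx orbT.
  by rewrite select0 !inE !eqs.
have [/lie_final//|[]] := lie_inv t; move: go sel.
rewrite -/(honest _) [lie t.+2]lieS /step; case: (lie t.+1) => p h; case: (honest t.+1) => q h' /=.
move=> + + -> _ hh; rewrite -hh => /negPf-> ->.
rewrite (success_ac _ _ _ _ _ dE) /deviation !compute /orders_manip !compute.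
by rewrite /ranking /= !compute /=; apply: swap_ac.
Qed.

Hypothesis coverage : forall (I : instance N) d,
  exists t, proposed_at I select (@truthful N) t d.

Lemma three_agents_manipulation : exists (d : deal N) (p p' : allocation manip),
  [/\ proposed_at manip select (@truthful N) 0 d, a \in val d,
      outcome select (@truthful N) p, outcome select (deviation a 0) p' &
      pref a (p' a) (p a)].
Proof.
have [ab ac bc] := neqs.
have ac2 : #|[set a; c]| == 2 by rewrite cards2 ac.
have bc2 : #|[set b; c]| == 2 by rewrite cards2 bc.
have [t1 /truth_bc t1P] := coverage manip (exist _ [set b; c] bc2 : deal N).
have [t2 /lie_ac t2P] := coverage calm (exist _ [set a; c] ac2 : deal N).
exists (select [::]), (manip_alloc a c b), (manip_alloc c a b); split.
- by split=> //; apply: not_stopped_nil.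
- by rewrite select0 !inE eqxx.
- exists t1.+1 => t /subnK<-; elim: (t - _) => [|k IH]; first exact: t1P.
  exact: truth_final.
- exists t2.+1 => t /subnK<-; elim: (t - _) => [|k IH]; first exact: t2P.
  by rewrite addSn addnS; apply: lie_final; rewrite -addnS.
- by rewrite !allocE !compute /orders_manip !compute /ranking /= !compute.
Qed.

End Runs.

End ThreeAgents.

Theorem proposition2 (sigma : selection_heuristic)
  (sigma_coverage : minimal_coverage sigma) : manipulable sigma.
Proof.
have N_gt1 : 1 < #|'I_3| by rewrite card_ord.
(* The deal selected on the empty history decides which agents play [a] and [b], before any instance
   is chosen. *)
have /cards2P[a [b [ab abE]]] := valP (sigma _ N_gt1 [::]).
have /set0Pn[c] : ~: [set a; b] != set0.
  by rewrite -card_gt0 cardsCs setCK card_ord cards2 ab.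
rewrite !inE negb_or ![c == _]eq_sym => /andP[ac bc].
have abc : uniq [:: a; b; c] by rewrite /= !inE negb_or ab ac bc.
have abcT i : i \in [:: a; b; c].
  have sub_enum : {subset [:: a; b; c] <= enum 'I_3} by move=> x _; apply: mem_enum.
  have [|_ ->] := uniq_min_size abc sub_enum; last exact: mem_enum.
  by rewrite size_enum_ord.
have [d [p [p' ?]]] := three_agents_manipulation abc abcT abE (sigma_coverage _ N_gt1).
by exists 'I_3, N_gt1, (manip abc abcT), a, 0, d, p, p'.
Qed.
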